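(* Let $\mathbf{A}\in\mathbb{R}^{d\times d}$ be symmetric positive definite with spectrum (set of eigenvalues) $\Lambda$, and let $\mathbf{b}\in\mathbb{R}^d$. Then for every integer $k\ge2$, the Lanczos-FA iterate satisfies $$\|\mathbf{A}^{-1/2}\mathbf{b}-\mathsf{lan}_k(x^{-1/2};\mathbf{A},\mathbf{b})\|_2\le\frac{3}{\sqrt{\pi k}}\,\kappa(\mathbf{A})\,\|\mathbf{b}\|_2\min_{\deg(p)<k/2}\left(\max_{x\in\Lambda}\left|\frac{1}{\sqrt{x}}-p(x)\right|\right),$$ where the minimum is over real polynomials $p$ of degree less than $k/2$.
   Context: For a symmetric matrix $\mathbf{M}=\sum_i\mu_i\mathbf{u}_i\mathbf{u}_i^{\mathsf T}$ (orthonormal eigendecomposition) and a scalar function $f$ defined on its eigenvalues, $f(\mathbf{M}):=\sum_i f(\mu_i)\mathbf{u}_i\mathbf{u}_i^{\mathsf T}$. The Krylov subspace is $\mathcal{K}_k(\mathbf{A},\mathbf{b})=\operatorname{span}\{\mathbf{b},\mathbf{A}\mathbf{b},\dots,\mathbf{A}^{k-1}\mathbf{b}\}$. Let $\mathbf{Q}$ be the matrix whose columns are the orthonormal basis of $\mathcal{K}_k(\mathbf{A},\mathbf{b})$ produced by the Lanczos algorithm in exact arithmetic (Gram–Schmidt applied to $\mathbf{b},\mathbf{A}\mathbf{b},\dots$; it has $\dim\mathcal{K}_k(\mathbf{A},\mathbf{b})$ columns), and let $\mathbf{T}=\mathbf{Q}^{\mathsf T}\mathbf{A}\mathbf{Q}$,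 which is symmetric tridiagonal. The Lanczos-FA iterate is $\mathsf{lan}_k(f;\mathbf{A},\mathbf{b}):=\mathbf{Q}f(\mathbf{T})\mathbf{Q}^{\mathsf T}\mathbf{b}$; $\mathsf{lan}_k(x^{-1/2};\mathbf{A},\mathbf{b})$ is the case $f(x)=x^{-1/2}$. $\kappa(\mathbf{A})$ is the condition number, the ratio of the largest to the smallest eigenvalue of $\mathbf{A}$. *)

(* Defs.v *)
From HB Require Import structures.
From mathcomp Require Import all_boot all_order all_algebra.
From mathcomp Require Import all_classical all_reals all_analysis.

Set Implicit Arguments.
Unset Strict Implicit.
Unset Printing Implicit Defensive.
Import Order.TTheory GRing.Theory Num.Theory.
Local Open Scope classical_set_scope.
Local Open Scope ring_scope.

Section Defs.
Variable R : realType.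

(* The library's own norm on matrices is the entrywise maximum, hence the
   following Euclidean notions. *)
Definition dotv n (u v : 'cV[R]_n) : R := \sum_i u i 0 * v i 0.

Definition norm2 n (v : 'cV[R]_n) : R := Num.sqrt (dotv v v).

Definition posdefmx n (A : 'M[R]_n) : Prop :=
  forall x : 'cV[R]_n, x != 0 -> 0 < dotv x (A *m x).

(* [eigenvalue] refers to row eigenvectors; the spectrum is the same as for
   column eigenvectors. *)
Definition spectrum n (A : 'M[R]_n) : set R := [set x | eigenvalue A x].

Definition cond_number n (A : 'M[R]_n) : R :=
  sup (spectrum A) / inf (spectrum A).

Definition spectral_sum n (U : 'M[R]_n) (mu : 'I_n -> R) : 'M[R]_n :=
  \sum_i mu i *: (col i U *m (col i U)^T).

Definition eigendecomposition n (M U : 'M[R]_n) (mu : 'I_n -> R) : Prop :=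
  U^T *m U = 1%:M /\ M = spectral_sum U mu.

(* For symmetric M the set below is a singleton: an orthonormal
   eigendecomposition exists and the value does not depend on its choice.
   When M is not symmetric the result is the dummy value 0. *)
Definition funmx n (f : R -> R) (M : 'M[R]_n) : 'M[R]_n :=
  xget 0 [set F | exists U mu,
    eigendecomposition M U mu /\ F = spectral_sum U (fun i => f (mu i))].

Definition krylov_seq d (A : 'M[R]_d) (b : 'cV[R]_d) (k : nat) :
    seq 'cV[R]_d :=
  mkseq (fun i => A ^+ i *m b) k.

(* A vector in the span of its predecessors contributes nothing, so that the
   length of the result is the dimension of the span of the input. *)
Definition gram_schmidt_step d (qs : seq 'cV[R]_d) (v : 'cV[R]_d) :
    seq 'cV[R]_d :=
  let w := v - \sum_(q <- qs) dotv q v *: q in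
  if w == 0 then qs else rcons qs ((norm2 w)^-1 *: w).

Definition gram_schmidt d (vs : seq 'cV[R]_d) : seq 'cV[R]_d :=
  foldl (@gram_schmidt_step d) [::] vs.

Definition lanczos_basis d (A : 'M[R]_d) (b : 'cV[R]_d) (k : nat) :
    seq 'cV[R]_d :=
  gram_schmidt (krylov_seq A b k).

Definition lanczosQ d (A : 'M[R]_d) (b : 'cV[R]_d) (k : nat) :
    'M[R]_(d, size (lanczos_basis A b k)) :=
  \matrix_(i, j) (nth 0 (lanczos_basis A b k) j) i 0.

Definition lanczosT d (A : 'M[R]_d) (b : 'cV[R]_d) (k : nat) :
    'M[R]_(size (lanczos_basis A b k)) :=
  (lanczosQ A b k)^T *m A *m lanczosQ A b k.

Definition lanczos_fa d (f : R -> R) (A : 'M[R]_d) (b : 'cV[R]_d)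
    (k : nat) : 'cV[R]_d :=
  lanczosQ A b k *m funmx f (lanczosT A b k) *m (lanczosQ A b k)^T *m b.

Definition inv_sqrt (x : R) : R := (Num.sqrt x)^-1.

Definition approx_error (S : set R) (f : R -> R) (p : {poly R}) : R :=
  sup [set `|f x - p.[x]| | x in S].

(* The infimum is attained when S is finite and nonempty. [(size p).-1] is the
   degree of p, except that the zero polynomial also gets 0. *)
Definition best_approx_error (S : set R) (f : R -> R) (m : R) : R :=
  inf [set approx_error S f p | p in [set p : {poly R} | ((size p).-1)%:R < m]].

End Defs.

(* Main.v *)
Require Import Defs.
From mathcomp Require Import all_boot all_order all_algebra.
From mathcomp Require Import all_classical all_reals all_analysis.
From mathcomp Require Import zify ring lra complex.
Import Order.TTheory GRing.Theory Num.Theory.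
Import numFieldNormedType.Exports.
Local Open Scope ring_scope.

(** Let [T] be the compression of [A] to the Krylov space, and let [p], [q] be
    the polynomials that interpolate [x^(-1/2)] and [1/x] at the eigenvalues of
    [T] (the Ritz values).  Since the Krylov space reproduces [s(A) b] for every
    polynomial [s] of degree less than [k] ([lanczos_poly_exact]), the iterates
    for the two functions are [p(A) b] and [q(A) b].  The bound comes from
    comparing them, the iterate for [1/x] being optimal in the [A]-norm.

    Comparison ([inv_sqrt_interpolation_le]).  Suppose that there are [n]
    distinct Ritz values [r_j], all in ]0, L].  Put [y = 1/x] and [y_j = 1/r_j]
    and multiply both interpolation errors by [y^(n-1)].  The error for [1/x]
    becomes a monic polynomial of degree [n] that vanishes at the [y_j], hence
    the product of the [y - y_j].  The error for [x^(-1/2)] becomes the error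
    made when [y^(n-1/2)] is interpolated at the [y_j] by a polynomial of degree
    less than [n], which by the mean value form of the remainder is the same
    product times the [n]th derivative of [y^(n-1/2)], divided by [n!], at
    some point [eta >= 1/L].  That factor is [w_n eta^(-1/2) <= w_n sqrt L], with
    [w_n] the central binomial coefficient of [2n] divided by [4^n].  So at every
    eigenvalue of [A] the first error is at most [sqrt L * w_n] times the second.
    If [n < k], the eigencomponents of [b] live on the Ritz values only
    ([ritz_support]), where both errors vanish; otherwise [n = k].  The product
    formula for the Wallis integrals gives [w_k <= 1 / sqrt (pi k)]
    ([wallis_le]).

    Optimality ([lanczos_inverse_optimal]).  The iterate [q(A) b] minimises the
    [A]-norm of [A^(-1) b - v] over the Krylov space.  If [s] approximates
    [x^(-1/2)] with error [e] on the spectrum and has degree less than [k/2],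
    then [s^2] is a competitor, and
    [sqrt x (1/x - s^2) = (x^(-1/2) - s) (2 - sqrt x (x^(-1/2) - s))]
    is at most [(2 + sqrt L * e) e].  With [l] and [L] the extreme eigenvalues
    and [rho = sqrt (L / l)], going back from the [A]-norm to the Euclidean norm
    costs [1 / sqrt l], and the error is at most
    [w_k rho (2 + sqrt L * e) e |b|] ([lanczos_inv_sqrt_error]).

    Finally, if [e <= l^(-1/2)], then [2 + sqrt L * e <= 2 + rho <= 3 rho], which
    gives the factor [3 rho^2].  A larger [e] is worse than the error of the zero
    polynomial, which is at most [l^(-1/2)]. *)

Set Implicit Arguments.
Unset Strict Implicit.
Unset Printing Implicit Defensive.

(** * Spectral theorem for real symmetric matrices *)

Section SpectralTheorem.
Variable R : realType.

(** Over the complex numbers [A] is unitarily diagonalisable with real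
    eigenvalues, so it is killed by a product of real linear factors; the
    identity descends to the reals. *)
Lemma symmetric_split_annihilator n (A : 'M[R]_n.+1) : A^T = A ->
  exists rs : seq R, \prod_(r <- rs) (A - r%:M) = 0.
Proof.
move=> A_sym; pose f := real_complex R; pose AC := map_mx f A.
have AC_herm : AC \is hermsymmx.
  apply: realsym_hermsym.
    apply/is_hermitianmxP; rewrite expr0 scale1r map_mx_id //.
    by rewrite /AC map_trmx A_sym.
  by apply/mxOverP => i j; rewrite mxE; apply/complex_realP; exists (A i j).
have /mxOverP D_real := hermitian_spectral_diag_real AC_herm.
have /orthomx_spectralP AC_E := hermitian_normalmx AC_herm.
set P := spectralmx AC in AC_E; set D := spectral_diag AC in AC_E D_real.
have P_unit : P \is a GRing.unit := spectral_unit AC.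
pose rs := [seq complex.Re (D 0 i) | i <- enum 'I_n.+1]; exists rs.
pose p := \prod_(r <- rs) ('X - r%:P).
have -> : \prod_(r <- rs) (A - r%:M) = horner_mx A p.
  rewrite /p rmorph_prod; apply: eq_bigr => r _.
  by rewrite rmorphB /= horner_mx_X horner_mx_C.
apply: (@map_mx_inj _ _ f); rewrite map_mx0 map_horner_mx -/AC AC_E.
rewrite horner_mx_uconjC // horner_mx_diag.
suff -> : map_mx (horner (map_poly f p)) D = 0.
  rewrite (_ : diag_mx 0 = 0) ?mulmx0 ?mul0mx //.
  by apply/matrixP => i j; rewrite !mxE mul0rn.
apply/matrixP => i j; rewrite !mxE ord1 {i}.
apply/rootP; rewrite /p map_prod_XsubC -(big_map _ xpredT (fun r => 'X - r%:P)).
rewrite root_prod_XsubC; apply/mapP; exists (complex.Re (D 0 j)).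
  by apply/mapP; exists j; rewrite ?mem_enum.
by have /complex_realP[x ->] := D_real 0 j.
Qed.

(** Apply the factors of an annihilating product to [w] one at a time: the last
    nonzero vector is an eigenvector.  Each factor preserves the orthogonal
    complement of the rows of [U]. *)
Lemma eigenrow_of_annihilator m n (A : 'M[R]_n) (U : 'M[R]_(m, n)) rs
    (w : 'rV_n) :
    (forall v : 'rV_n, v *m U^T = 0 -> v *m A *m U^T = 0) ->
    w != 0 -> w *m U^T = 0 -> w *m \prod_(r <- rs) (A - r%:M) = 0 ->
  exists r (v : 'rV_n), [/\ v != 0, v *m U^T = 0 & v *m A = r *: v].
Proof.
move=> A_stable; elim: rs w => [|r rs IHrs] w w_neq0 wU.
  by rewrite big_nil mulmx1 => w0; rewrite w0 eqxx in w_neq0.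
rewrite big_cons mulmxA; have [w0 _|w'_neq0] := eqVneq (w *m (A - r%:M)) 0.
  exists r, w; split=> //; apply/eqP.
  by rewrite -subr_eq0 -mul_mx_scalar -mulmxBr w0.
by apply: IHrs => //; rewrite mulmxBr mulmxBl A_stable // mul_mx_scalar
  -scalemxAl wU scaler0 subrr.
Qed.

Lemma dotmulE n (v w : 'rV[R]_n) : (v *m w^T) 0 0 = \sum_i v 0 i * w 0 i.
Proof. by rewrite mxE; apply: eq_bigr => i _; rewrite mxE. Qed.

(** The rows are built one by one: the orthogonal complement of the eigenrows
    found so far is stable under the symmetric [A], so it contains a further
    eigenrow. *)
Lemma orthonormal_eigenrows n (A : 'M[R]_n) m : A^T = A -> (m <= n)%N ->
  exists (U : 'M[R]_(m, n)) (mu : 'rV_m),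
    U *m U^T = 1%:M /\ U *m A = diag_mx mu *m U.
Proof.
move=> A_sym; elim: m => [|m IHm] m_le_n.
  by exists 0, 0; split; apply/matrixP => -[].
have [U [mu [UUT UA]]] := IHm (ltnW m_le_n).
case: n => [//|n] in A A_sym U UUT UA m_le_n {IHm} *.
have [w w_neq0 wU] : exists2 w : 'rV_n.+1, w != 0 & w *m U^T = 0.
  have: kermx U^T != 0.
    rewrite kermx_eq0 -row_leq_rank -ltnNge mxrank_tr.
    exact: leq_ltn_trans (rank_leq_row U) m_le_n.
  by case/rowV0Pn => w /sub_kermxP wU w_neq0; exists w.
have A_stable (v : 'rV_n.+1) : v *m U^T = 0 -> v *m A *m U^T = 0.
  move=> vU; rewrite -mulmxA -{1}A_sym -trmx_mul UA trmx_mul mulmxA vU.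
  by rewrite mul0mx.
have [rs prod0] := symmetric_split_annihilator A_sym.
have [|r [v [v_neq0 vU vA]]] := 
  eigenrow_of_annihilator A_stable w_neq0 wU (rs := rs).
  by rewrite prod0 mulmx0.
pose c := Num.sqrt ((v *m v^T) 0 0).
have vv_gt0 : 0 < (v *m v^T) 0 0.
  rewrite lt_neqAle eq_sym dotmulE psumr_neq0 => [|i _]; last exact: sqr_ge0.
  rewrite sumr_ge0 ?andbT => [|i _]; last exact: sqr_ge0.
  have [i vi] : exists i, v 0 i != 0 by apply/rV0Pn.
  apply/hasP; exists i; rewrite ?mem_index_enum //=.
  by rewrite -expr2 exprn_even_gt0.
have vvT : c^-1 *: v *m (c^-1 *: v)^T = 1%:M.
  rewrite linearZ /= -scalemxAl -scalemxAr scalerA.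
  rewrite [v *m v^T]mx11_scalar scale_scalar_mx -expr2 exprVn.
  by rewrite sqr_sqrtr ?ltW // mulVf ?gt_eqF.
(* The block operations need the row dimension in the form [1 + m]. *)
suff: exists (U' : 'M[R]_(1 + m, n.+1)) (mu' : 'rV_(1 + m)),
  U' *m U'^T = 1%:M /\ U' *m A = diag_mx mu' *m U' by [].
exists (col_mx (c^-1 *: v) U), (row_mx r%:M mu); split.
  rewrite tr_col_mx mul_col_row UUT vvT -scalemxAl vU scaler0.
  rewrite linearZ /= -scalemxAr -[U *m v^T]trmxK trmx_mul trmxK vU trmx0.
  by rewrite scaler0 -scalar_mx_block.
rewrite mul_col_mx UA diag_mx_row mul_block_col !mul0mx addr0 add0r.
have -> : diag_mx r%:M = r%:M :> 'M[R]_1.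
  by apply/matrixP => i j; rewrite !ord1 !mxE.
by rewrite mul_scalar_mx -scalemxAl vA !scalerA mulrC.
Qed.

Lemma spectral_sumE n (U : 'M[R]_n) (mu : 'I_n -> R) :
  spectral_sum U mu = U *m diag_mx (\row_i mu i) *m U^T.
Proof.
rewrite mul_mx_diag; apply/matrixP => i j.
rewrite /spectral_sum summxE mxE; apply: eq_bigr => l _.
by rewrite !mxE big_ord_recl big_ord0 !mxE addr0 mulrCA mulrA.
Qed.

Theorem symmetric_eigendecomposition n (A : 'M[R]_n) : A^T = A ->
  exists U mu, eigendecomposition A U mu.
Proof.
move=> A_sym; have [V [mu [VVT VA]]] := orthonormal_eigenrows A_sym (leqnn n).
exists V^T, (fun i => mu 0 i); split; first by rewrite trmxK.
rewrite spectral_sumE trmxK -mulmxA.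
rewrite (_ : \row_i mu 0 i = mu); last by apply/rowP => i; rewrite mxE.
by rewrite -VA mulmxA (mulmx1C VVT) mul1mx.
Qed.

End SpectralTheorem.

(** * Functions of a matrix in an orthonormal eigenbasis *)

Section FunctionalCalculus.
Variable R : realType.

Lemma eigendecomposition_orthogonal n (M U : 'M[R]_n) mu :
  eigendecomposition M U mu -> U *m U^T = 1%:M.
Proof. by case=> /mulmx1C. Qed.

Lemma spectral_sum_mulmx_eigen n (U : 'M[R]_n) mu :
  U^T *m U = 1%:M -> spectral_sum U mu *m U = U *m diag_mx (\row_i mu i).
Proof. by move=> UTU; rewrite spectral_sumE -mulmxA UTU mulmx1. Qed.

(** The value does not depend on the decomposition: the change of basis [Z]
    between two decompositions intertwines the diagonal matrices of eigenvalues,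
    so it only links equal eigenvalues, and therefore also intertwines their
    images under [f]. *)
Lemma funmxE n (f : R -> R) (M U : 'M[R]_n) mu :
  eigendecomposition M U mu -> funmx f M = spectral_sum U (fun i => f (mu i)).
Proof.
move=> MU; have UUT := eigendecomposition_orthogonal MU; case: MU => UTU M_E.
apply: xget_subset1; first by exists U, mu.
move=> _ _ [V [nu [[VTV MV] ->]]] [W [xi [[WTW MW] ->]]].
have /mulmx1C WWT := WTW; have /mulmx1C VVT := VTV.
pose Z := V^T *m W.
have Z_E : diag_mx (\row_i nu i) *m Z = Z *m diag_mx (\row_i xi i).
  rewrite /Z -mulmxA -(spectral_sum_mulmx_eigen _ WTW) -MW MV spectral_sumE.
  by rewrite !mulmxA VTV mul1mx.
suff fZ : diag_mx (\row_i f (nu i)) *m Z = Z *m diag_mx (\row_i f (xi i)).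
  rewrite !spectral_sumE -[LHS]mulmx1 -WWT mulmxA -[_ *m V^T *m W]mulmxA -/Z.
  by rewrite -[X in X *m W^T]mulmxA fZ /Z !mulmxA VVT mul1mx.
apply/matrixP => i j; have /matrixP/(_ i j) := Z_E.
rewrite !mul_diag_mx !mul_mx_diag !mxE; set z := \sum_(_ < _) _ => /eqP.
rewrite mulrC -subr_eq0 -mulrBr mulf_eq0 => /orP[/eqP->|].
  by rewrite mulr0 mul0r.
by rewrite subr_eq0 => /eqP->; rewrite mulrC.
Qed.

Lemma spectral_sum_exp n (M U : 'M[R]_n) mu i :
  eigendecomposition M U mu ->
  M ^+ i = spectral_sum U (fun j => mu j ^+ i).
Proof.
move=> MU; have UUT := eigendecomposition_orthogonal MU; case: MU => UTU M_E.
elim: i => [|i IHi].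
  rewrite expr0 spectral_sumE (_ : diag_mx _ = 1%:M) ?mulmx1 ?UUT //.
  by apply/matrixP => a c; rewrite !mxE.
rewrite exprS IHi M_E -[_ * _]/(_ *m _) !spectral_sumE !mulmxA.
rewrite -[_ *m U^T *m U]mulmxA UTU mulmx1 -[U *m _ *m _]mulmxA.
rewrite mulmx_diag; congr (_ *m diag_mx _ *m _).
by apply/rowP => j; rewrite !mxE exprS.
Qed.

Lemma spectral_sum_horner n (M U : 'M[R]_n) mu k (p : {poly R}) :
  eigendecomposition M U mu -> (size p <= k)%N ->
  spectral_sum U (fun j => p.[mu j]) = \sum_(i < k) p`_i *: M ^+ i.
Proof.
move=> MU p_size; rewrite /spectral_sum.
under [LHS]eq_bigr do rewrite (horner_coef_wide _ p_size) scaler_suml.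
rewrite exchange_big /=; apply: eq_bigr => i _.
rewrite (spectral_sum_exp _ MU) /spectral_sum scaler_sumr.
by apply: eq_bigr => j _; rewrite scalerA.
Qed.

Lemma spectral_sum_mulcol n (U : 'M[R]_n) mu (b : 'cV[R]_n) :
  spectral_sum U mu *m b = U *m \col_i (mu i * (U^T *m b) i 0).
Proof.
rewrite spectral_sumE -!mulmxA; congr (_ *m _).
by rewrite mul_diag_mx; apply/colP => i; rewrite !mxE.
Qed.

Lemma dotvE n (u v : 'cV[R]_n) : dotv u v = (u^T *m v) 0 0.
Proof. by rewrite mxE; apply: eq_bigr => i _; rewrite mxE. Qed.

Lemma dotvC n (u v : 'cV[R]_n) : dotv u v = dotv v u.
Proof. by apply: eq_bigr => i _; rewrite mulrC. Qed.

Lemma dotv_ge0 n (v : 'cV[R]_n) : 0 <= dotv v v.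
Proof. by apply: sumr_ge0 => i _; rewrite -expr2 sqr_ge0. Qed.

Lemma dotv_gt0 n (v : 'cV[R]_n) : v != 0 -> 0 < dotv v v.
Proof.
move=> v_neq0; rewrite lt_neqAle eq_sym dotv_ge0 andbT psumr_neq0 => [|i _].
  have [i vi] : exists i, v i 0 != 0 by apply/cV0Pn.
  by apply/hasP; exists i; rewrite ?mem_index_enum //= -expr2 exprn_even_gt0.
by rewrite -expr2 sqr_ge0.
Qed.

Lemma dotv_isometry m n (Q : 'M[R]_(m, n)) (u v : 'cV_n) :
  Q^T *m Q = 1%:M -> dotv (Q *m u) (Q *m v) = dotv u v.
Proof.
by move=> QTQ; rewrite !dotvE trmx_mul mulmxA -[_ *m Q^T *m Q]mulmxA QTQ mulmx1.
Qed.

Lemma norm2_isometry m n (Q : 'M[R]_(m, n)) (v : 'cV_n) :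
  Q^T *m Q = 1%:M -> norm2 (Q *m v) = norm2 v.
Proof. by move=> QTQ; rewrite /norm2 dotv_isometry. Qed.

Lemma dotv_spectral_sum n (U : 'M[R]_n) mu (u v : 'cV[R]_n) :
  dotv u (spectral_sum U mu *m v) =
  \sum_i mu i * (U^T *m u) i 0 * (U^T *m v) i 0.
Proof.
rewrite dotvE spectral_sum_mulcol mulmxA -[u^T *m U]trmxK trmx_mul trmxK.
rewrite -dotvE.
by apply: eq_bigr => i _; rewrite [X in _ * X]mxE mulrCA mulrA.
Qed.

Lemma eigenvalue_eigendecomposition n (M U : 'M[R]_n) mu x :
  eigendecomposition M U mu -> eigenvalue M x <-> exists i, x = mu i.
Proof.
move=> MU; have UUT := eigendecomposition_orthogonal MU; case: MU => UTU M_E.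
split=> [/eigenvalueP[v vM v_neq0]|[i ->]].
  have: v *m U != 0.
    apply: contraNneq v_neq0 => vU0.
    by rewrite -[v]mulmx1 -UUT mulmxA vU0 mul0mx.
  case/rV0Pn => i vUi; exists i; apply: (mulfI vUi).
  have: v *m M *m U = v *m U *m diag_mx (\row_i mu i).
    by rewrite -mulmxA {1}M_E spectral_sum_mulmx_eigen // mulmxA.
  rewrite vM -scalemxAl => /matrixP/(_ 0 i).
  by rewrite mul_mx_diag !mxE => <-; rewrite mulrC.
apply/eigenvalueP; exists (row i U^T).
  rewrite M_E spectral_sumE -row_mul !mulmxA UTU mul1mx.
  by rewrite mul_diag_mx; apply/rowP => j; rewrite !mxE.
apply/negP => /eqP Ui0.
have /matrixP/(_ i i) := UTU; rewrite !mxE eqxx => /eqP.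
rewrite big1 => [|j _]; first by rewrite eq_sym oner_eq0.
by have /rowP/(_ j) := Ui0; rewrite !mxE => ->; rewrite mul0r.
Qed.

End FunctionalCalculus.

(** * The Lanczos basis *)

Section Lanczos.
Variable R : realType.

(** Stated with indices, so that repeated vectors are excluded as well. *)
Definition orthonormal_seq d (qs : seq 'cV[R]_d) : Prop :=
  forall i j, (i < size qs)%N -> (j < size qs)%N ->
    dotv (nth 0 qs i) (nth 0 qs j) = (i == j)%:R.

Definition in_orthonormal_span d (qs : seq 'cV[R]_d) (v : 'cV[R]_d) : Prop :=
  v = \sum_(q <- qs) dotv q v *: q.

Lemma dotvDr n (u v w : 'cV[R]_n) : dotv u (v + w) = dotv u v + dotv u w.
Proof. by rewrite !dotvE mulmxDr mxE. Qed.

Lemma dotvZr n a (u v : 'cV[R]_n) : dotv u (a *: v) = a * dotv u v.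
Proof. by rewrite !dotvE -scalemxAr mxE. Qed.

Lemma dotv_sumr n I (r : seq I) (F : I -> 'cV[R]_n) u :
  dotv u (\sum_(i <- r) F i) = \sum_(i <- r) dotv u (F i).
Proof.
by rewrite dotvE mulmx_sumr summxE; apply: eq_bigr => i _; rewrite dotvE.
Qed.

Lemma gram_schmidt_residual_orthogonal d (qs : seq 'cV[R]_d) v i :
    orthonormal_seq qs -> (i < size qs)%N ->
  dotv (nth 0 qs i) (v - \sum_(q <- qs) dotv q v *: q) = 0.
Proof.
move=> qs_on i_lt; rewrite dotvDr -scaleN1r dotvZr dotv_sumr (big_nth 0).
rewrite big_mkord (bigD1 (Ordinal i_lt)) //= big1 => [|j ji].
  by rewrite dotvZr qs_on // eqxx mulr1 addr0 mulN1r subrr.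
have /negbTE ij : i != j by rewrite eq_sym.
by rewrite dotvZr qs_on // ij mulr0.
Qed.

Lemma gram_schmidt_step_orthonormal d (qs : seq 'cV[R]_d) v :
  orthonormal_seq qs -> orthonormal_seq (gram_schmidt_step qs v).
Proof.
move=> qs_on; rewrite /gram_schmidt_step.
set w := v - _; case: ifPn => // w_neq0.
have w_gt0 := dotv_gt0 w_neq0.
have qw i : (i < size qs)%N -> dotv (nth 0 qs i) ((norm2 w)^-1 *: w) = 0.
  by move=> i_lt; rewrite dotvZr gram_schmidt_residual_orthogonal // mulr0.
move=> i j; rewrite size_rcons !ltnS => i_le j_le; rewrite !nth_rcons.
case: (ltngtP i (size qs)) i_le => // [i_lt|->] _;
  case: (ltngtP j (size qs)) j_le => // [j_lt|j_eq] _.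
- exact: qs_on.
- by rewrite j_eq qw // ltn_eqF.
- by rewrite dotvC qw.
rewrite dotvZr dotvC dotvZr /norm2 mulrA -expr2 exprVn.
by rewrite sqr_sqrtr ?dotv_ge0 // mulVf ?gt_eqF.
Qed.

(** A vector of the old span is orthogonal to the new direction, so its
    expansion does not change; the new vector is the residual plus its old
    projection. *)
Lemma gram_schmidt_step_span d (qs : seq 'cV[R]_d) v u :
  orthonormal_seq qs -> in_orthonormal_span qs u \/ u = v ->
  in_orthonormal_span (gram_schmidt_step qs v) u.
Proof.
move=> qs_on; rewrite /gram_schmidt_step /in_orthonormal_span.
set w := v - _; have [w0|w_neq0] := eqVneq w 0.
  by case=> // ->; apply/eqP; rewrite -subr_eq0 -/w w0.
have w_gt0 := dotv_gt0 w_neq0.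
have qw i : (i < size qs)%N -> dotv (nth 0 qs i) w = 0.
  by move=> i_lt; rewrite gram_schmidt_residual_orthogonal.
have w_span : dotv w (\sum_(q <- qs) dotv q u *: q) = 0.
  rewrite dotv_sumr big_seq big1 // => q /(nthP 0)[i i_lt <-].
  by rewrite dotvZr [dotv w _]dotvC qw // mulr0.
have w_span_v : dotv w (\sum_(q <- qs) dotv q v *: q) = 0.
  rewrite dotv_sumr big_seq big1 // => q /(nthP 0)[i i_lt <-].
  by rewrite dotvZr [dotv w _]dotvC qw // mulr0.
rewrite -cats1 big_cat big_seq1 /= => -[u_span|->].
  rewrite dotvC dotvZr [dotv u w]dotvC {3}u_span w_span mulr0 scale0r addr0.
  exact: u_span.
have v_E : v = w + \sum_(q <- qs) dotv q v *: q by rewrite subrK.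
have wv : dotv w v = dotv w w by rewrite {1}v_E dotvDr w_span_v addr0.
rewrite dotvC dotvZr [dotv v w]dotvC wv scalerA mulrC mulrA -expr2 exprVn.
by rewrite sqr_sqrtr ?dotv_ge0 // mulVf ?gt_eqF // scale1r addrC.
Qed.

Lemma gram_schmidt_orthonormal d (vs : seq 'cV[R]_d) :
  orthonormal_seq (gram_schmidt vs).
Proof.
elim/last_ind: vs => [|vs v IHvs]; first by [].
by rewrite /gram_schmidt foldl_rcons; apply: gram_schmidt_step_orthonormal.
Qed.

Lemma gram_schmidt_span d (vs : seq 'cV[R]_d) v :
  v \in vs -> in_orthonormal_span (gram_schmidt vs) v.
Proof.
elim/last_ind: vs => [|vs u IHvs]; first by [].
rewrite mem_rcons inE /gram_schmidt foldl_rcons => v_in.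
apply: gram_schmidt_step_span; first exact: gram_schmidt_orthonormal.
by case/orP: v_in => [/eqP->|/IHvs]; [right | left].
Qed.

Lemma size_gram_schmidt d (vs : seq 'cV[R]_d) :
  (size (gram_schmidt vs) <= size vs)%N.
Proof.
elim/last_ind: vs => [|vs v IHvs]; first by [].
rewrite /gram_schmidt foldl_rcons size_rcons /gram_schmidt_step.
by case: ifP => _; rewrite ?size_rcons ?ltnS //; apply: leqW.
Qed.

Variables (d : nat) (A : 'M[R]_d) (b : 'cV[R]_d) (k : nat).
Let Q := lanczosQ A b k.

Lemma size_lanczos_basis : (size (lanczos_basis A b k) <= k)%N.
Proof. by rewrite (leq_trans (size_gram_schmidt _)) // size_mkseq. Qed.

Lemma col_lanczosQ j : col j Q = nth 0 (lanczos_basis A b k) j.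
Proof. by apply/colP => i; rewrite !mxE. Qed.

Lemma lanczosQ_orthonormal : Q^T *m Q = 1%:M.
Proof.
apply/matrixP => i j.
have := @gram_schmidt_orthonormal d (krylov_seq A b k) _ _ (ltn_ord i) (ltn_ord j).
rewrite mxE -/(lanczos_basis A b k) /dotv => dot_ij; rewrite [RHS]mxE.
by rewrite -val_eqE -[in RHS]dot_ij; apply: eq_bigr => l _; rewrite !mxE.
Qed.

Lemma lanczosQ_krylov i : (i < k)%N -> Q *m Q^T *m (A ^+ i *m b) = A ^+ i *m b.
Proof.
move=> i_lt; set v := A ^+ i *m b.
have /gram_schmidt_span : v \in krylov_seq A b k.
  by apply/mapP; exists i; rewrite ?mem_iota.
rewrite /in_orthonormal_span -/(lanczos_basis A b k) => v_E.
rewrite [RHS]v_E (big_nth 0) big_mkord -mulmxA.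
apply/colP => a; rewrite mxE summxE; apply: eq_bigr => j _.
rewrite -col_lanczosQ !mxE mulrC; congr (_ * _).
by apply: eq_bigr => l _; rewrite !mxE.
Qed.

Lemma lanczosT_sym : A^T = A -> (lanczosT A b k)^T = lanczosT A b k.
Proof. by move=> A_sym; rewrite /lanczosT !trmx_mul trmxK A_sym mulmxA. Qed.

(** As long as [A ^+ i *m b] stays in the range of [Q], the projection
    [Q *m Q^T] inside the powers of [T] acts as the identity. *)
Lemma lanczosT_exp i :
  (i < k)%N -> Q *m lanczosT A b k ^+ i *m Q^T *m b = A ^+ i *m b.
Proof.
elim: i => [|i IHi] i_lt.
  by have := lanczosQ_krylov i_lt; rewrite !expr0 mulmx1 !mul1mx.
rewrite exprS -[_ * _]/(_ *m _) /lanczosT -/Q.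
have := IHi (ltnW i_lt); rewrite /lanczosT -/Q -!mulmxA => ->.
by rewrite [A *m (_ *m _)]mulmxA -[A *m _]/(A * _) -exprS mulmxA lanczosQ_krylov.
Qed.

Lemma lanczos_poly_exact (U : 'M[R]_d) la
    (V : 'M[R]_(size (lanczos_basis A b k))) th (p : {poly R}) :
    eigendecomposition A U la -> eigendecomposition (lanczosT A b k) V th ->
    (size p <= k)%N ->
  Q *m spectral_sum V (fun j => p.[th j]) *m Q^T *m b =
  spectral_sum U (fun j => p.[la j]) *m b.
Proof.
move=> AU TV p_size; rewrite (spectral_sum_horner AU p_size).
rewrite (spectral_sum_horner TV p_size) mulmx_sumr !mulmx_suml.
by apply: eq_bigr => i _; rewrite -scalemxAr -!scalemxAl lanczosT_exp.
Qed.

End Lanczos.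

(** * The Wallis inequality *)

Section Wallis.
Variable R : realType.

(** This is the central binomial coefficient of [2 * n] divided by [4 ^ n]; up to
    the factor [pi / 2] it is the integral of [cos ^+ (2 * n)] over
    [[0, pi / 2]]. *)
Definition wallis (n : nat) : R := \prod_(i < n) ((2 * i + 1)%:R / (2 * i + 2)%:R).

Lemma wallis_ge0 n : 0 <= wallis n.
Proof. by apply: prodr_ge0 => i _; rewrite divr_ge0 ?ler0n. Qed.

(** The reduction formula obtained by integrating [cos ^+ n] by parts.  With
    these explicit primitives the Wallis integrals are mere values at [pi / 2]. *)
Fixpoint cos_pow_primitive (n : nat) : R -> R :=
  match n with
  | 0 => id
  | 1 => sin
  | m.+2 => ((m.+2)%:R^-1 \*: (cos ^+ m.+1 * sin)
             + (m.+1%:R / m.+2%:R) \*: cos_pow_primitive m)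
  end.

Lemma is_derive_cos_pow_primitive n (x : R) :
  is_derive x 1 (cos_pow_primitive n) (cos x ^+ n).
Proof.
suff: is_derive x 1 (cos_pow_primitive n) (cos x ^+ n) /\
      is_derive x 1 (cos_pow_primitive n.+1) (cos x ^+ n.+1) by case.
elim: n => [|n [IHn IHn1]].
  by rewrite expr0 expr1; split; [exact: is_derive_id | exact: is_derive_sin].
split=> //=; apply: is_derive_eq.
rewrite -![_ *: _]/(_ * _) !fctE !exprS /=.
have := sin2cos2 x; rewrite expr2 => s2.
have -> : n.+2%:R = n.+1%:R + 1 :> R by rewrite -natr1.
have n1 : n.+1%:R + 1 != 0 :> R by rewrite natr1 pnatr_eq0.
move: (n.+1%:R) n1 => N N1.
(* Dividing by [N + 1 = n.+2], isolate [sin ^+ 2] so as to trade it for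
   [1 - cos ^+ 2]. *)
transitivity ((N + 1)^-1 * (cos x ^+ n * cos x ^+ 2 -
  cos x ^+ n * N * (sin x * sin x) + N * cos x ^+ n)).
  by field.
by rewrite s2; field.
Qed.

Definition wallis_integral n : R := cos_pow_primitive n (pi / 2).

Lemma cos_pow_primitive0 n : cos_pow_primitive n 0 = 0.
Proof.
suff: cos_pow_primitive n 0 = 0 /\ cos_pow_primitive n.+1 0 = 0 by case.
elim: n => [|n [IHn IHn1]]; first by rewrite /= sin0.
split=> //=.
by rewrite !fctE /= sin0 IHn mulr0 !scaler0 addr0.
Qed.

Lemma wallis_integral_rec n :
  wallis_integral n.+2 = n.+1%:R / n.+2%:R * wallis_integral n.
Proof.
rewrite /wallis_integral /= !fctE /= cos_pihalf expr0n /= mul0r scaler0 add0r.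
by [].
Qed.

Lemma wallis_integral_even n : wallis_integral (2 * n) = wallis n * (pi / 2).
Proof.
elim: n => [|n IHn]; first by rewrite /wallis big_ord0 mul1r.
rewrite mulnS add2n wallis_integral_rec IHn /wallis big_ord_recr /=.
by rewrite addn1 addn2; ring.
Qed.

(** By the reduction formula the left-hand side does not depend on [n]. *)
Lemma wallis_integral_mul n :
  n.+1%:R * (wallis_integral n.+1 * wallis_integral n) = pi / 2.
Proof.
elim: n => [|n IHn].
  by rewrite /wallis_integral /= sin_pihalf !mul1r.
have n2 : n.+2%:R != 0 :> R by rewrite pnatr_eq0.
by rewrite wallis_integral_rec -IHn; move: (n.+2%:R) n2 => N n2; field.
Qed.

(** The integrand decreases with the exponent because [0 <= cos <= 1]; in terms
    of primitives, the difference has a nonnegative derivative. *)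
Lemma wallis_integral_le n : wallis_integral n.+1 <= wallis_integral n.
Proof.
pose f := cos_pow_primitive n - cos_pow_primitive n.+1.
have df (x : R) : is_derive x 1 f (cos x ^+ n - cos x ^+ n.+1).
  by apply: is_deriveB; exact: is_derive_cos_pow_primitive.
have pi2 : 0 <= pi / 2 :> R by rewrite divr_ge0 ?pi_ge0.
have [|c c_in] := MVT_segment pi2 (fun x _ => df x).
  apply: continuous_subspaceT => x.
  by apply: differentiable_continuous; apply/derivable1_diffP; case: (df x).
rewrite subr0 {2}/f !fctE !cos_pow_primitive0 subrr subr0 => f_pi2.
rewrite -subr_ge0 -[_ - _]/(f (pi / 2)) f_pi2 mulr_ge0 // exprS.
rewrite -[X in X - _]mul1r -mulrBl mulr_ge0 ?subr_ge0 ?cos_le1 //.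
rewrite exprn_ge0 // cos_ge0_pihalf //.
move: c_in; rewrite in_itv /= => /andP[c0 ->].
by rewrite andbT (le_trans _ c0) // oppr_le0.
Qed.

(** With [J_m] the integral of [cos ^+ m], the square of [J_(2n)] is at most
    [J_(2n) * J_(2n-1)], which equals [pi / (4 n)]. *)
Lemma wallis_le n : (0 < n)%N -> wallis n <= (Num.sqrt (pi * n%:R))^-1.
Proof.
case: n => // n _; set N := n.+1%:R.
have N_gt0 : 0 < N by rewrite ltr0n.
have pi_gt0 := pi_gt0 R.
have w_ge0 := wallis_ge0 n.+1.
have J_E := wallis_integral_even n.+1.
have J_le := wallis_integral_le (2 * n).+1.
have J_mul := wallis_integral_mul (2 * n).+1.
have N2 : (2 * n).+2%:R = 2 * N by rewrite -natrM mulnS.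
rewrite mulnS add2n in J_E; rewrite N2 J_E in J_mul; rewrite J_E in J_le.
rewrite -(ler_pXn2r (n := 2)) ?nnegrE ?invr_ge0 ?sqrtr_ge0 //.
have piN_gt0 : 0 < pi * N by rewrite mulr_gt0.
rewrite exprVn sqr_sqrtr ?(ltW piN_gt0) //.
rewrite -[X in _ <= X]mul1r ler_pdivlMr //.
set J := wallis_integral _ in J_mul J_le.
have : wallis n.+1 * (pi / 2) * (wallis n.+1 * (pi / 2)) <= wallis n.+1 * (pi / 2) * J.
  by rewrite ler_wpM2l // mulr_ge0 // divr_ge0 // ltW.
move=> le1.
rewrite -(ler_pM2r (_ : 0 < pi / 2)) ?divr_gt0 // mul1r -[leRHS]J_mul.
clearbody N; move: (wallis _) le1 {J_le J_mul J_E w_ge0} => w le1.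
rewrite [leLHS](_ : _ = 2 * N * (w * (pi / 2) * (w * (pi / 2)))).
  by rewrite ler_pM2l ?mulr_gt0.
by field.
Qed.

End Wallis.

(** * Comparison of interpolation errors *)

Section Interpolation.
Variable R : realType.

(** The conclusion keeps the zeros of the derivative sorted and to the right of
    [x], which is the form needed to iterate. *)
Lemma rolle_zeros (f df : R -> R) (a x : R) (s : seq R) :
    (forall t, a < t -> is_derive t 1 f (df t)) ->
    a < x -> path <%R x s -> all (fun t => f t == 0) (x :: s) ->
  exists s', [/\ size s' = size s, path <%R x s' & all (fun t => df t == 0) s'].
Proof.
move=> f_df; elim: s x => [|y s IHs] x ax; first by exists [::].
move=> /= /andP[xy y_path] /and3P[/eqP fx fy fs].
have [s' [s'_size s'_path s'0]] := IHs y (lt_trans ax xy) y_path (introT andP (conj fy fs)).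
have [||c] := Rolle xy _ _ (etrans fx (esym (eqP fy))).
- by move=> t; rewrite in_itv => /andP[xt _]; case: (f_df t (lt_trans ax xt)).
- apply: derivable_within_continuous => t; rewrite in_itv => /andP[xt _].
  by case: (f_df t (lt_le_trans ax xt)).
rewrite in_itv /= => /andP[xc cy] fc.
have dfc := f_df c (lt_trans ax xc).
exists (c :: s'); split=> /=; first by rewrite s'_size.
  rewrite xc /=; case: s' s'_path {s'_size s'0} => //= z s' /andP[yz ->].
  by rewrite (lt_trans cy yz).
by rewrite s'0 andbT -(@derive_val _ _ _ _ _ _ _ dfc) (@derive_val _ _ _ _ _ _ _ fc).
Qed.

Lemma iterated_rolle n (F : nat -> R -> R) (a x : R) (s : seq R) :
    (forall i t, a < t -> is_derive t 1 (F i) (F i.+1 t)) ->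
    a < x -> path <%R x s -> all (fun t => F 0 t == 0) (x :: s) -> size s = n ->
  exists2 y, x <= y & F n y = 0.
Proof.
move=> F_dF; elim: n F F_dF x s => [|n IHn] F F_dF x s ax x_path F0 s_size.
  by exists x => //; case/andP: F0 => /eqP.
have [s' [s'_size s'_path F1]] := rolle_zeros (F_dF 0%N) ax x_path F0.
case: s' => [|y s'] in s'_size s'_path F1; first by rewrite s_size in s'_size.
case/andP: s'_path => xy y_path; rewrite s_size in s'_size; case: s'_size => s'_size.
have [z yz Fz] := IHn (fun i => F i.+1) (fun i => F_dF i.+1) y s'
  (lt_trans ax xy) y_path F1 s'_size.
by exists z => //; exact: le_trans (ltW xy) yz.
Qed.

(** The coefficient of the [i]th derivative of [y `^ (n - 1/2)]. *)
Definition half_falling n i : R := \prod_(j < i) (n%:R - 2^-1 - j%:R).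

(** Read in reverse order, the factors of [half_falling n n] are the
    [j + 1/2] for [j < n]. *)
Lemma half_falling_wallis n : half_falling n n = n`!%:R * wallis R n.
Proof.
have -> : n`!%:R = \prod_(i < n) (i.+1)%:R :> R.
  by rewrite fact_prod natr_prod big_add1 big_mkord.
rewrite /half_falling /wallis -big_split (reindex_inj rev_ord_inj) /=.
apply: eq_bigr => i _; rewrite natrB ?ltn_ord //.
have i1 : i.+1%:R != 0 :> R by rewrite pnatr_eq0.
have -> : (2 * i + 1)%:R = 2 * i.+1%:R - 1 :> R by rewrite -natr1 natrD natrM; ring.
have -> : (2 * i + 2)%:R = 2 * i.+1%:R :> R by rewrite -natrM; congr _%:R; lia.
by move: (i.+1%:R) i1 => N N0; field.
Qed.

Lemma is_derive_half_power n (P : {poly R}) i (t : R) : 0 < t ->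
  is_derive t 1
    (fun y => half_falling n i * y `^ (n%:R - 2^-1 - i%:R) - P^`(i).[y])
    (half_falling n i.+1 * t `^ (n%:R - 2^-1 - i.+1%:R) - P^`(i.+1).[t]).
Proof.
move=> t_gt0; rewrite derivnS.
have := is_deriveB (is_deriveZ (half_falling n i)
  (is_derive1_powR (n%:R - 2^-1 - i%:R) t_gt0)) (is_derive_poly P^`(i) t).
move/is_derive_eq; apply; congr (_ - _).
rewrite -[_ *: _]/(_ * _) mulrA {2}/half_falling big_ord_recr /=.
by congr (_ * _ `^ _); rewrite -natr1; ring.
Qed.

(** Subtract from [y `^ (n - 1/2)] the interpolant [P] and the multiple [c] of the
    nodal polynomial that makes the difference vanish at [Y] too.  With [n + 1]
    zeros, its [n]th derivative has a zero [y >= a]; there the interpolant has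
    disappeared, and [c] is [wallis n / sqrt y]. *)
Lemma half_power_interpolation_error (ys : seq R) (P : {poly R}) (a Y : R) n :
    size ys = n -> 0 < a -> uniq ys -> (size P <= n)%N -> all (>= a) ys -> a <= Y ->
    (forall y, y \in ys -> y `^ (n%:R - 2^-1) = P.[y]) -> Y \notin ys ->
  `|Y `^ (n%:R - 2^-1) - P.[Y]| <=
    wallis R n / Num.sqrt a * `|(\prod_(y <- ys) ('X - y%:P)).[Y]|.
Proof.
move=> ys_size a_gt0 ys_uniq P_size ys_ge aY P_interp Y_notin.
set N := \prod_(y <- ys) _.
have N_Y : N.[Y] != 0 by rewrite -[_ == 0]/(root N Y) root_prod_XsubC.
have N_size : size N = n.+1 by rewrite size_prod_XsubC ys_size.
have N_lead : N`_n = 1.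
  have := lead_coef_prod_XsubC ys xpredT id; rewrite /lead_coef.
  by rewrite -/N N_size.
pose c := (Y `^ (n%:R - 2^-1) - P.[Y]) / N.[Y].
pose F i y := half_falling n i * y `^ (n%:R - 2^-1 - i%:R)
              - (P + c *: N)^`(i).[y].
have F_dF i (t : R) : 0 < t -> is_derive t 1 (F i) (F i.+1 t).
  exact: is_derive_half_power.
have F0 y : y \in Y :: ys -> F 0%N y == 0.
  rewrite /F /half_falling big_ord0 mul1r subr0 derivn0 hornerD hornerZ inE.
  case/predU1P => [->|y_in]; first by rewrite /c divfK // addrCA subrr addr0 subrr.
  have /rootP-> : root N y by rewrite root_prod_XsubC.
  by rewrite mulr0 addr0 P_interp // subrr.
have [y ay Fy] : exists2 y, a <= y & F n y = 0.
  pose zs := sort <=%R (Y :: ys).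
  have zs_mem : zs =i Y :: ys by apply: mem_sort.
  have : size zs = n.+1 by rewrite size_sort /= ys_size.
  have : sorted <%R zs by rewrite sort_lt_sorted /= Y_notin.
  case: zs zs_mem => [//|z zs] zs_mem zs_path [zs_size].
  have az : a <= z.
    have : z \in Y :: ys by rewrite -zs_mem mem_head.
    by rewrite inE => /predU1P[->//|]; apply/allP.
  have [|y zy Fy] := iterated_rolle F_dF (lt_le_trans a_gt0 az) zs_path _ zs_size.
    by apply/allP => t; rewrite zs_mem; exact: F0.
  by exists y => //; exact: le_trans zy.
have derivE : (P + c *: N)^`(n) = (c * n`!%:R)%:P.
  apply/polyP => i; rewrite coef_derivn coefD coefZ coefC.
  rewrite (nth_default 0 (leq_trans P_size (leq_addr i n))) add0r.
  case: i => [|i]; first by rewrite addn0 N_lead ffactnn mulr1 mulr_natr.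
  by rewrite (nth_default 0 (n := (n + i.+1)%N)) ?mulr0 ?mul0rn // N_size; lia.
have y_gt0 := lt_le_trans a_gt0 ay.
have c_E : c = wallis R n / Num.sqrt y.
  have n_neq0 : n`!%:R != 0 :> R by rewrite pnatr_eq0 -lt0n fact_gt0.
  move: Fy; rewrite /F derivE hornerC half_falling_wallis => /eqP.
  have -> : n%:R - 2^-1 - n%:R = - 2^-1 :> R by ring.
  rewrite powRN powR12_sqrt ?ltW // subr_eq0 => /eqP E.
  by apply: (mulIf n_neq0); rewrite -E; ring.
have w_ge0 := wallis_ge0 R n.
have -> : Y `^ (n%:R - 2^-1) - P.[Y] = c * N.[Y] by rewrite divfK.
rewrite normrM ler_wpM2r // c_E ger0_norm ?divr_ge0 ?sqrtr_ge0 //.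
by rewrite ler_wpM2l // lef_pV2 ?posrE ?sqrtr_gt0 // ler_wsqrtr.
Qed.

(** For [size p <= n], this is [y ^+ n.-1 * p.[y^-1]] as a polynomial in [y]. *)
Definition rev_poly n (p : {poly R}) : {poly R} := \poly_(i < n) p`_(n.-1 - i).

Lemma horner_rev_poly n (p : {poly R}) y : (size p <= n)%N -> y != 0 ->
  (rev_poly n p).[y] = y ^+ n.-1 * p.[y^-1].
Proof.
move=> p_size y_neq0; rewrite horner_poly (horner_coef_wide _ p_size).
rewrite (reindex_inj rev_ord_inj) mulr_sumr /=; apply: eq_bigr => i _.
have i_lt := ltn_ord i.
rewrite (_ : n.-1 - (n - i.+1) = i)%N; last by lia.
rewrite mulrCA; congr (_ * _).
rewrite exprVn (_ : n.-1 = (n - i.+1) + i)%N; last by lia.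
by rewrite exprD mulfK // expf_neq0.
Qed.

(** In the variable [y = x^-1], and after multiplication by [y ^+ n.-1], the error
    for [x^-1] is the nodal polynomial itself, while the error for [inv_sqrt] is
    that of [y `^ (n - 1/2)]. *)
Lemma inv_sqrt_interpolation_le (rs : seq R) (p q : {poly R}) (L x : R) n :
    size rs = n -> (0 < n)%N -> uniq rs ->
    (forall r, r \in rs -> 0 < r <= L) -> 0 < x <= L ->
    (size p <= n)%N -> (size q <= n)%N ->
    (forall r, r \in rs -> p.[r] = inv_sqrt r) ->
    (forall r, r \in rs -> q.[r] = r^-1) ->
  `|inv_sqrt x - p.[x]| <= Num.sqrt L * wallis R n * `|x^-1 - q.[x]|.
Proof.
move=> rs_size n_gt0 rs_uniq rs_bnd /andP[x_gt0 xL] p_size q_size p_rs q_rs.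
have [x_in|x_notin] := boolP (x \in rs).
  by rewrite p_rs // q_rs // !subrr normr0 mulr0.
have L_gt0 := lt_le_trans x_gt0 xL.
pose ys := [seq r^-1 | r <- rs].
have ys_size : size ys = n by rewrite size_map.
have ys_uniq : uniq ys by rewrite map_inj_uniq //; exact: invr_inj.
have powE (y : R) : 0 < y -> y `^ (n%:R - 2^-1) = y ^+ n.-1 * inv_sqrt y^-1.
  move=> y_gt0; have y_ge0 := ltW y_gt0.
  rewrite /inv_sqrt sqrtrV // invrK -powR12_sqrt // -powR_mulrn //.
  rewrite -powRD; last by rewrite gt_eqF // implybT.
  by congr (_ `^ _); rewrite -[in LHS](prednK n_gt0) -natr1; field.
have Y_gt0 : 0 < x^-1 by rewrite invr_gt0.
have P_size : (size (rev_poly n p) <= n)%N by exact: size_poly.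
have := @half_power_interpolation_error ys (rev_poly n p) L^-1 x^-1 n ys_size.
rewrite invr_gt0 lef_pV2 ?posrE // (sqrtrV (ltW L_gt0)) invrK.
move=> /(_ L_gt0 ys_uniq P_size).
rewrite powE // horner_rev_poly ?gt_eqF // invrK.
have -> : \prod_(y <- ys) ('X - y%:P) = 'X^n - rev_poly n q.
  have size_lt : (size (rev_poly n q) < size ('X^n : {poly R}))%N.
    by rewrite size_polyXn ltnS; exact: size_poly.
  have -> : 'X^n - rev_poly n q = lead_coef ('X^n - rev_poly n q) *: 
     \prod_(y <- ys) ('X - y%:P).
    apply: all_roots_prod_XsubC.
    - by rewrite size_polyDl ?size_polyN // size_polyXn ys_size.
    - apply/allP => _ /mapP[r r_in ->]; have /andP[r_gt0 _] := rs_bnd r r_in.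
      apply/rootP; rewrite hornerD hornerN hornerXn.
      rewrite horner_rev_poly ?invr_eq0 ?gt_eqF // invrK q_rs //.
      by rewrite -exprSr prednK // subrr.
    by rewrite uniq_rootsE.
  by rewrite lead_coefDl ?size_polyN // lead_coefXn scale1r.
rewrite hornerD hornerN hornerXn horner_rev_poly ?gt_eqF // invrK.
rewrite -[in X in X - _ * q.[x]](prednK n_gt0) exprSr -!mulrBr !normrM.
rewrite mulrCA ler_pM2l ?normr_gt0 ?expf_neq0 ?gt_eqF //.
rewrite [Num.sqrt L * _]mulrC; apply=> //.
- apply/allP => _ /mapP[r r_in ->]; have /andP[r_gt0 rL] := rs_bnd r r_in.
  by rewrite /= lef_pV2 ?posrE.
- move=> _ /mapP[r r_in ->]; have /andP[r_gt0 rL] := rs_bnd r r_in.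
  rewrite powE ?invr_gt0 // horner_rev_poly ?invr_eq0 ?gt_eqF //.
  by rewrite invrK p_rs.
by rewrite (mem_map invr_inj).
Qed.

Lemma interpolation_exists (rs : seq R) (f : R -> R) : uniq rs ->
  exists2 p : {poly R}, (size p <= size rs)%N & forall r, r \in rs -> p.[r] = f r.
Proof.
elim: rs => [|r rs IHrs]; first by exists 0; rewrite // size_poly0.
move=> /= /andP[r_notin /IHrs[p p_size p_rs]].
pose N := \prod_(z <- rs) ('X - z%:P).
have N_r : N.[r] != 0 by rewrite -[_ == 0]/(root N r) root_prod_XsubC.
exists (p + ((f r - p.[r]) / N.[r]) *: N).
  rewrite (leq_trans (size_polyD _ _)) // geq_max (leq_trans p_size) //=.
  by rewrite (leq_trans (size_scale_leq _ _)) // size_prod_XsubC.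
move=> z; rewrite inE hornerD hornerZ => /predU1P[->|z_in].
  by rewrite divfK // addrCA subrr addr0.
have /rootP-> : root N z by rewrite root_prod_XsubC.
by rewrite mulr0 addr0 p_rs.
Qed.

End Interpolation.

(** * Error bounds for the Lanczos iterates *)

Section Bound.
Variable R : realType.

Lemma mulmx_spectral_sum n (M U : 'M[R]_n) mu f :
  eigendecomposition M U mu ->
  M *m spectral_sum U f = spectral_sum U (fun i => mu i * f i).
Proof.
case=> UTU ->; rewrite !spectral_sumE !mulmxA -[U *m _ *m U^T *m U]mulmxA UTU.
rewrite mulmx1 -[U *m _ *m _]mulmxA mulmx_diag.
by congr (_ *m diag_mx _ *m _); apply/rowP => i; rewrite !mxE.
Qed.

Lemma rayleigh_eigenvector n (M U : 'M[R]_n) mu i :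
  eigendecomposition M U mu ->
  dotv (col i U) (col i U) = 1 /\ dotv (col i U) (M *m col i U) = mu i.
Proof.
case=> UTU ->; have Ui : U^T *m col i U = delta_mx i 0.
  by rewrite colE mulmxA UTU mul1mx.
have delta_sum (g : 'I_n -> R) :
    \sum_j g j * (delta_mx i 0 : 'cV[R]_n) j 0 * (delta_mx i 0 : 'cV[R]_n) j 0 = g i.
  rewrite (bigD1 i) //= big1 => [|j /negbTE ji]; rewrite !mxE.
    by rewrite !eqxx !mulr1 addr0.
  by rewrite ji mulr0.
rewrite dotv_spectral_sum Ui delta_sum; split=> //.
have UUT := mulmx1C UTU; have Uii : U^T^T *m U^T = 1%:M by rewrite trmxK.
rewrite -(dotv_isometry _ _ Uii) Ui.
rewrite -[RHS](delta_sum (fun=> 1)).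
by apply: eq_bigr => j _; rewrite mul1r.
Qed.

Lemma rayleigh_le n (M U : 'M[R]_n) mu (L : R) x :
  eigendecomposition M U mu -> (forall i, mu i <= L) ->
  dotv x (M *m x) <= L * dotv x x.
Proof.
move=> MU mu_le; have UUT := eigendecomposition_orthogonal MU.
have Uii : U^T^T *m U^T = 1%:M by rewrite trmxK.
rewrite -(dotv_isometry x x Uii); case: MU => _ ->.
rewrite dotv_spectral_sum mulr_sumr; apply: ler_sum => i _.
by rewrite -mulrA ler_wpM2r // -expr2 sqr_ge0.
Qed.

Lemma eigenvalue_gt0 n (M U : 'M[R]_n) mu i :
  posdefmx M -> eigendecomposition M U mu -> 0 < mu i.
Proof.
move=> M_pos MU; have [u1 <-] := rayleigh_eigenvector i MU; apply: M_pos.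
apply: contra_eq_neq u1 => ->; rewrite dotvE mulmx0 mxE.
by rewrite eq_sym oner_eq0.
Qed.

Section LanczosSpectrum.
Variables (d : nat) (A : 'M[R]_d) (b : 'cV[R]_d) (k : nat).
Variables (U : 'M[R]_d) (la : 'I_d -> R).
Variables (V : 'M[R]_(size (lanczos_basis A b k)))
          (th : 'I_(size (lanczos_basis A b k)) -> R).
Hypothesis A_pos : posdefmx A.
Hypothesis AU : eigendecomposition A U la.
Hypothesis TV : eigendecomposition (lanczosT A b k) V th.

Let Q := lanczosQ A b k.
Let beta i := (U^T *m b) i 0.

(** A Ritz value is the Rayleigh quotient of [A] at a unit vector of the Krylov
    space. *)
Lemma ritz_value_bounds (L : R) j :
  (forall i, la i <= L) -> 0 < th j <= L.
Proof.
move=> la_le; have [v1 vT] := rayleigh_eigenvector j TV.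
pose x := Q *m col j V.
have x1 : dotv x x = 1 by rewrite dotv_isometry //; exact: lanczosQ_orthonormal.
have <- : dotv x (A *m x) = th j.
  rewrite -vT !dotvE /lanczosT -/Q /x trmx_mul.
  by congr (_ 0 0); rewrite !mulmxA.
rewrite (le_trans (rayleigh_le _ AU la_le)) ?x1 ?mulr1 // andbT.
apply: A_pos; apply: contra_eq_neq x1 => ->; rewrite dotvE mulmx0 mxE.
by rewrite eq_sym oner_eq0.
Qed.

(** The nodal polynomial [N] of the distinct Ritz values satisfies [N(T) = 0].
    When its degree is less than [k], exactness gives [N(A) b = 0]. *)
Lemma ritz_support i : (size (undup (codom th)) < k)%N ->
  beta i = 0 \/ la i \in codom th.
Proof.
move=> th_lt; pose N := \prod_(r <- undup (codom th)) ('X - r%:P).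
have N_size : (size N <= k)%N by rewrite size_prod_XsubC.
have NE x : root N x = (x \in codom th) by rewrite root_prod_XsubC mem_undup.
have := lanczos_poly_exact AU TV N_size.
have -> : spectral_sum V (fun j => N.[th j]) = 0.
  apply: big1 => j _; have /rootP-> : root N (th j) by rewrite NE codom_f.
  by rewrite scale0r.
rewrite mulmx0 !mul0mx spectral_sum_mulcol => /esym/(congr1 (mulmx U^T)).
case: (AU) => UTU _; rewrite mulmxA UTU mul1mx mulmx0 => /colP/(_ i).
rewrite !mxE => /eqP; rewrite mulf_eq0 => /orP[N0|/eqP beta0].
  by right; rewrite -NE.
by left; rewrite /beta mxE.
Qed.

(** The residual [b - A q(A) b] is orthogonal to the Krylov space, hence to
    [s(A) b]; the sum is their inner product in the eigenbasis of [A]. *)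
Lemma lanczos_galerkin (q s : {poly R}) :
    (forall j, th j * q.[th j] = 1) -> (size q <= k)%N -> (size s <= k)%N ->
  \sum_i (1 - la i * q.[la i]) * s.[la i] * beta i ^+ 2 = 0.
Proof.
move=> q_inv q_size s_size.
have b_E : b = U *m (U^T *m b).
  by rewrite mulmxA (eigendecomposition_orthogonal AU) mul1mx.
pose y := spectral_sum V (fun j => q.[th j]) *m Q^T *m b.
have Qy : Q *m y = spectral_sum U (fun i => q.[la i]) *m b.
  by rewrite -(lanczos_poly_exact AU TV q_size) /y !mulmxA.
have Ty : lanczosT A b k *m y = Q^T *m b.
  rewrite /y !mulmxA (mulmx_spectral_sum _ TV).
  rewrite (_ : spectral_sum _ _ = 1%:M) ?mul1mx //.
  rewrite spectral_sumE (_ : diag_mx _ = 1%:M) ?mulmx1.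
    exact: eigendecomposition_orthogonal TV.
  by apply/matrixP => i j; rewrite !mxE q_inv.
have Q_resid : Q^T *m (b - A *m (Q *m y)) = 0.
  by rewrite mulmxBr -Ty /lanczosT -/Q !mulmxA subrr.
have : dotv (spectral_sum U (fun i => s.[la i]) *m b) (b - A *m (Q *m y)) = 0.
  rewrite -(lanczos_poly_exact AU TV s_size) -/Q dotvE -!mulmxA trmx_mul.
  by rewrite -mulmxA Q_resid mulmx0 mxE.
have -> : b - A *m (Q *m y) = spectral_sum U (fun i => 1 - la i * q.[la i]) *m b.
  rewrite Qy mulmxA (mulmx_spectral_sum _ AU) !spectral_sum_mulcol {1}b_E.
  rewrite -mulmxBr; congr (_ *m _); apply/colP => i; rewrite !mxE; ring.
case: (AU) => UTU _.
rewrite !spectral_sum_mulcol dotv_isometry // => dot0; rewrite -[RHS]dot0 /dotv.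
by apply: eq_bigr => i _; rewrite !mxE /beta !mxE; ring.
Qed.

(** Pythagoras in the [A]-norm, the sums being squared [A]-norms of
    [A^-1 b - q(A) b] and [A^-1 b - s(A) b]: the first of these vectors is
    [A]-orthogonal to the Krylov space. *)
Lemma lanczos_inverse_optimal (q s : {poly R}) :
    (forall j, th j * q.[th j] = 1) -> (size q <= k)%N -> (size s <= k)%N ->
  \sum_i la i * ((la i)^-1 - q.[la i]) ^+ 2 * beta i ^+ 2 <=
  \sum_i la i * ((la i)^-1 - s.[la i]) ^+ 2 * beta i ^+ 2.
Proof.
move=> q_inv q_size s_size.
have qs_size : (size (q - s)%R <= k)%N.
  by rewrite (leq_trans (size_polyD _ _)) // size_polyN geq_max q_size.
have orth := lanczos_galerkin q_inv q_size qs_size.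
have la_gt0 i : 0 < la i := eigenvalue_gt0 i A_pos AU.
rewrite -subr_ge0 (_ : _ - _ =
    \sum_i la i * (q.[la i] - s.[la i]) ^+ 2 * beta i ^+ 2
    + 2 * \sum_i (1 - la i * q.[la i]) * (q - s).[la i] * beta i ^+ 2).
  rewrite orth mulr0 addr0; apply: sumr_ge0 => i _.
  by rewrite mulr_ge0 ?sqr_ge0 // mulr_ge0 ?sqr_ge0 // ltW.
rewrite -sumrB mulr_sumr -big_split; apply: eq_bigr => i _ /=.
by rewrite hornerD hornerN; field; rewrite gt_eqF.
Qed.

End LanczosSpectrum.

Lemma lanczos_fa_interpolation d (A : 'M[R]_d) (b : 'cV[R]_d) k
    (U : 'M[R]_d) la (V : 'M[R]_(size (lanczos_basis A b k))) th f
    (p : {poly R}) :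
    eigendecomposition A U la -> eigendecomposition (lanczosT A b k) V th ->
    (size p <= k)%N -> (forall j, p.[th j] = f (th j)) ->
  funmx f A *m b - lanczos_fa f A b k =
  U *m \col_i ((f (la i) - p.[la i]) * (U^T *m b) i 0).
Proof.
move=> AU TV p_size p_f; rewrite /lanczos_fa (funmxE f AU) (funmxE f TV).
have -> : spectral_sum V (fun j => f (th j)) = spectral_sum V (fun j => p.[th j]).
  by apply: eq_bigr => j _; rewrite p_f.
rewrite (lanczos_poly_exact AU TV p_size) !spectral_sum_mulcol -mulmxBr.
by congr (_ *m _); apply/colP => i; rewrite !mxE mulrBl.
Qed.

Lemma norm2_sqr n (v : 'cV[R]_n) : norm2 v ^+ 2 = \sum_i v i 0 ^+ 2.
Proof.
by rewrite sqr_sqrtr ?dotv_ge0. Qed.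

(** The chain described at the top: compare with the iterate for [1/x], pass to
    the [A]-norm at the cost of [1 / sqrt l], and use [s * s] as a competitor in
    the optimality of that iterate. *)
Lemma lanczos_inv_sqrt_error d (A : 'M[R]_d) (b : 'cV[R]_d) k (U : 'M[R]_d) la
    (l L e : R) (s : {poly R}) :
    A^T = A -> posdefmx A -> eigendecomposition A U la -> (0 < k)%N ->
    0 < l -> (forall i, l <= la i <= L) -> 0 <= e -> ((size s + size s).-1 <= k)%N ->
    (forall i, `|inv_sqrt (la i) - s.[la i]| <= e) ->
  norm2 (funmx (@inv_sqrt R) A *m b - lanczos_fa (@inv_sqrt R) A b k) <=
    wallis R k * (Num.sqrt L / Num.sqrt l) * ((2 + Num.sqrt L * e) * e) * norm2 b.
Proof.
move=> A_sym A_pos AU k_gt0 l_gt0 la_bnd e_ge0 s_size s_e.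
have [V [th TV]] := symmetric_eigendecomposition (lanczosT_sym b k A_sym).
have la_le i : la i <= L by case/andP: (la_bnd i).
have th_bnd j := ritz_value_bounds A_pos AU TV j la_le.
pose rs := undup (codom th); pose n := size rs.
have rs_uniq : uniq rs := undup_uniq _.
have th_rs j : th j \in rs by rewrite mem_undup codom_f.
have rs_bnd r : r \in rs -> 0 < r <= L.
  by rewrite mem_undup => /codomP[j ->].
have n_le : (n <= k)%N.
  rewrite (leq_trans (size_undup _)) // size_codom card_ord.
  exact: size_lanczos_basis.
have [p p_size p_rs] := interpolation_exists (@inv_sqrt R) rs_uniq.
have [q q_size q_rs] := interpolation_exists (@GRing.inv R) rs_uniq.
have pk := leq_trans p_size n_le; have qk := leq_trans q_size n_le.
rewrite (lanczos_fa_interpolation AU TV pk (fun j => p_rs _ (th_rs j))).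
case: (AU) => UTU _; rewrite norm2_isometry //.
set beta := U^T *m b; set err := \col_i _.
set sL := Num.sqrt L; set sl := Num.sqrt l; set w := wallis R k.
have w_ge0 : 0 <= w := wallis_ge0 R k.
have sl_gt0 : 0 < sl by rewrite sqrtr_gt0.
have sL_ge0 : 0 <= sL by rewrite sqrtr_ge0.
pose M := (2 + sL * e) * e.
have M_ge0 : 0 <= M by rewrite mulr_ge0 // addr_ge0 // mulr_ge0.
have la_gt0 i : 0 < la i := eigenvalue_gt0 i A_pos AU.
(* With fewer than [k] Ritz values, each component vanishes on both sides. *)
have err_le i : `|err i 0| <= sL * w * `|((la i)^-1 - q.[la i]) * beta i 0|.
  rewrite mxE !normrM mulrA.
  have [n_lt|n_ge] := ltnP n k; last first.
    have nk : n = k by apply/eqP; rewrite eqn_leq n_le n_ge.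
    rewrite ler_wpM2r // /w -nk.
    apply: (inv_sqrt_interpolation_le (rs := rs)) => //; rewrite ?nk //.
    by rewrite la_gt0 la_le.
  have [beta0|la_in] := ritz_support AU TV i n_lt.
    by rewrite beta0 normr0 !mulr0.
  by rewrite -mem_undup in la_in; rewrite p_rs // q_rs // !subrr normr0 mulr0.
have s2_le i : la i * ((la i)^-1 - (s * s).[la i]) ^+ 2 <= M ^+ 2.
  set x := la i; have x_gt0 := la_gt0 i; pose r := Num.sqrt x.
  have r_gt0 : 0 < r by rewrite sqrtr_gt0.
  have x_E : x = r ^+ 2 by rewrite sqr_sqrtr // ltW.
  have rL : r <= sL := ler_wsqrtr (la_le i).
  have := s_e i; rewrite -/x /inv_sqrt -/r hornerM; move: s.[x] => t t_e.
  have -> : x * (x^-1 - t * t) ^+ 2 = ((r^-1 - t) * (2 - r * (r^-1 - t))) ^+ 2.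
    by rewrite x_E; field; rewrite gt_eqF.
  set D := r^-1 - t in t_e *.
  rewrite -real_normK ?num_real // ler_pXn2r ?nnegrE // normrM mulrC.
  apply: ler_pM => //; apply: le_trans (ler_normB _ _) _.
  rewrite normr_nat lerD2l normrM (ger0_norm (ltW r_gt0)).
  by apply: ler_pM => //; exact: ltW.
have norm_le : norm2 err ^+ 2 <= (w * (sL / sl) * M * norm2 beta) ^+ 2.
  have lE : sl ^+ 2 = l by rewrite sqr_sqrtr // ltW.
  have -> : (w * (sL / sl) * M * norm2 beta) ^+ 2 =
      (sL * w) ^+ 2 * (l^-1 * (M ^+ 2 * norm2 beta ^+ 2)).
    by rewrite -lE; field; rewrite gt_eqF.
  rewrite !norm2_sqr.
  apply: (@le_trans _ _ (\sum_i (sL * w) ^+ 2 * (((la i)^-1 - q.[la i]) * beta i 0) ^+ 2)).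
    apply: ler_sum => i _; rewrite -[leLHS]real_normK ?num_real //.
    rewrite -[X in _ * X]real_normK ?num_real // -exprMn.
    by rewrite ler_pXn2r ?nnegrE ?mulr_ge0.
  rewrite -mulr_sumr.
  apply: ler_wpM2l; first exact: sqr_ge0.
  rewrite mulrC ler_pdivlMr // mulrC.
  have s2_size : (size (s * s)%R <= k)%N.
    by rewrite (leq_trans (size_polyMleq _ _)).
  have q_inv j : th j * q.[th j] = 1.
    by rewrite q_rs // mulfV // gt_eqF //; case/andP: (th_bnd j).
  apply: le_trans (le_trans (lanczos_inverse_optimal A_pos AU TV q_inv qk s2_size) _).
    rewrite mulr_sumr; apply: ler_sum => i _.
    rewrite exprMn mulrA ler_wpM2r ?sqr_ge0 // ler_wpM2r ?sqr_ge0 //.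
    by case/andP: (la_bnd i).
  rewrite mulr_sumr; apply: ler_sum => i _.
  by rewrite ler_wpM2r ?sqr_ge0.
have beta_norm : norm2 beta = norm2 b.
  by rewrite norm2_isometry // trmxK (eigendecomposition_orthogonal AU).
rewrite -beta_norm -ler_sqr ?nnegrE ?sqrtr_ge0 //.
apply: mulr_ge0; last exact: sqrtr_ge0.
by apply: mulr_ge0 => //; apply: mulr_ge0 => //; apply: divr_ge0 => //; exact: ltW.
Qed.

(** For [e <= inv_sqrt l] the factor [2 + sqrt L * e] is at most three times
    [sqrt (L / l)], whose remaining power turns into the condition number. *)
Lemma lanczos_inv_sqrt_cond d (A : 'M[R]_d) (b : 'cV[R]_d) k (U : 'M[R]_d) la
    (l L e : R) (s : {poly R}) :
    A^T = A -> posdefmx A -> eigendecomposition A U la -> (0 < k)%N ->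
    0 < l <= L -> (forall i, l <= la i <= L) -> ((size s + size s).-1 <= k)%N ->
    (forall i, `|inv_sqrt (la i) - s.[la i]| <= e) -> 0 <= e <= inv_sqrt l ->
  norm2 (funmx (@inv_sqrt R) A *m b - lanczos_fa (@inv_sqrt R) A b k) <=
    3 / Num.sqrt (pi * k%:R) * (L / l) * norm2 b * e.
Proof.
move=> A_sym A_pos AU k_gt0 /andP[l_gt0 lL] la_bnd s_size s_e /andP[e_ge0 e_le].
apply: le_trans
  (lanczos_inv_sqrt_error b A_sym A_pos AU k_gt0 l_gt0 la_bnd e_ge0 s_size s_e) _.
have w_ge0 := wallis_ge0 R k.
have L_gt0 := lt_le_trans l_gt0 lL.
have sl_gt0 : 0 < Num.sqrt l by rewrite sqrtr_gt0.
pose rho := Num.sqrt L / Num.sqrt l; rewrite -/rho.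
have rho_ge1 : 1 <= rho by rewrite ler_pdivlMr // mul1r; exact: ler_wsqrtr.
have rho_ge0 := le_trans ler01 rho_ge1.
have -> : L / l = rho ^+ 2.
  by rewrite exprMn exprVn !sqr_sqrtr // ltW.
have sLe : Num.sqrt L * e <= rho by rewrite ler_wpM2l ?sqrtr_ge0.
rewrite [leRHS](_ : _ = (Num.sqrt (pi * k%:R))^-1 * (3 * rho ^+ 2 * e) * norm2 b);
  last by ring.
apply: ler_wpM2r; first exact: sqrtr_ge0.
rewrite -mulrA; apply: ler_pM (wallis_le R k_gt0) _ => //.
  by rewrite mulr_ge0 // mulr_ge0 // addr_ge0 // mulr_ge0 ?sqrtr_ge0.
rewrite mulrA; apply: ler_wpM2r => //.
rewrite expr2 mulrCA; apply: ler_wpM2l => //.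
apply: le_trans (lerD (lexx 2) sLe) _; lra.
Qed.

End Bound.

(** * The main bound *)

Lemma has_ubound_range (R : realType) n (f : 'I_n -> R) : has_ubound (range f).
Proof.
exists (\sum_j `|f j|) => _ [i _ <-]; rewrite (bigD1 i) //=.
by apply: le_trans (ler_norm _) _; rewrite lerDl sumr_ge0.
Qed.

Lemma has_lbound_range (R : realType) n (f : 'I_n -> R) : has_lbound (range f).
Proof.
exists (- \sum_j `|f j|) => _ [i _ <-]; rewrite (bigD1 i) //= lerNl.
by rewrite (le_trans (ler_norm _)) // normrN lerDl sumr_ge0.
Qed.

Lemma le_mul_inf (R : realType) (S : set R) (C x : R) :
  (S !=set0)%classic -> 0 <= C -> (forall e, S e -> x <= C * e) -> x <= C * inf S.
Proof.
move=> S_n0; rewrite le_eqVlt => /predU1P[<- x_le|C_gt0 x_le].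
  by have [e Se] := S_n0; have := x_le e Se; rewrite !mul0r.
rewrite mulrC -ler_pdivrMr //; apply: lb_le_inf => // e Se.
by rewrite ler_pdivrMr // mulrC x_le.
Qed.

Unset Implicit Arguments.

Theorem theorem6 (R : realType) (d : nat) (A : 'M[R]_d) (b : 'cV[R]_d)
    (A_sym : A^T = A) (A_posdef : posdefmx A) (k : nat) (k_ge2 : (2 <= k)%N) :
  norm2 (funmx (@inv_sqrt R) A *m b - lanczos_fa (@inv_sqrt R) A b k) <=
    3 / Num.sqrt (pi * k%:R) * cond_number A * norm2 b *
    best_approx_error (spectrum A) (fun x => 1 / Num.sqrt x) (k%:R / 2).
Proof.
have norm2_0 (v : 'cV[R]_0) : norm2 v = 0 by rewrite /norm2 /dotv big_ord0 sqrtr0.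
case: d => [|d] in A b A_sym A_posdef *.
  by rewrite !norm2_0 mulr0 mul0r.
have [U [la AU]] := symmetric_eigendecomposition A_sym.
have specE : spectrum A = range la.
  apply/seteqP; split=> x /=.
    by case/(eigenvalue_eigendecomposition _ AU) => i ->; exists i.
  by case=> i _ <-; apply/(eigenvalue_eigendecomposition _ AU); exists i.
have range_n0 (f : 'I_d.+1 -> R) : (range f !=set0)%classic.
  by exists (f ord0); exists ord0.
rewrite /cond_number specE.
set l := inf _; set L := sup _.
have la_bnd i : l <= la i <= L.
  apply/andP; split.
    by apply: ge_inf; [exact: has_lbound_range | exists i].
  by apply: ub_le_sup; [exact: has_ubound_range | exists i].
have lL : l <= L by case/andP: (la_bnd ord0) => /le_trans; apply.
have l_gt0 : 0 < l.
  have [i0 _ i0_min] := @arg_minP _ _ _ ord0 xpredT la isT.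
  apply: lt_le_trans (eigenvalue_gt0 i0 A_posdef AU) _.
  by apply: lb_le_inf => // _ [i _ <-]; exact: i0_min.
have k_gt0 : (0 < k)%N := ltnW k_ge2.
have C_ge0 : 0 <= 3 / Num.sqrt (pi * k%:R) * (L / l) * norm2 b.
  apply: mulr_ge0; last exact: sqrtr_ge0.
  apply: mulr_ge0; first by rewrite divr_ge0 ?sqrtr_ge0.
  by rewrite divr_ge0 ?(ltW l_gt0) // (le_trans (ltW l_gt0)).
apply: le_mul_inf => //.
  exists (approx_error (range la) (fun x => 1 / Num.sqrt x) 0), 0 => //=.
  by rewrite size_poly0 divr_gt0 ?ltr0n.
move=> _ [p /= p_deg <-]; set E := approx_error _ _ _.
have p_size : ((size p + size p).-1 <= k)%N.
  by move: p_deg; rewrite ltr_pdivlMr // -natrM ltr_nat; case: (size p) => [|m]; lia.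
have p_E i : `|inv_sqrt (la i) - p.[la i]| <= E.
  apply: ub_le_sup; last by exists (la i); [exists i | rewrite /inv_sqrt div1r].
  rewrite image_comp; exact: has_ubound_range.
have E_ge0 : 0 <= E := le_trans (normr_ge0 _) (p_E ord0).
have [E_le|E_gt] := leP E (inv_sqrt l).
  by apply: (lanczos_inv_sqrt_cond b A_sym A_posdef AU _ _ la_bnd p_size p_E) => //;
    rewrite ?l_gt0 ?E_ge0.
(* Here [p] does worse than the zero polynomial. *)
have l_inv : 0 <= inv_sqrt l by rewrite invr_ge0 sqrtr_ge0.
apply: le_trans (ler_wpM2l C_ge0 (ltW E_gt)).
apply: (lanczos_inv_sqrt_cond (s := 0) b A_sym A_posdef AU _ _ la_bnd) => //.
- by rewrite l_gt0.
- by rewrite size_poly0.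
- move=> i; have /andP[l_la _] := la_bnd i; have la_gt0 := lt_le_trans l_gt0 l_la.
  rewrite horner0 subr0 ger0_norm ?invr_ge0 ?sqrtr_ge0 //.
  by rewrite lef_pV2 ?posrE ?sqrtr_gt0 //; exact: ler_wsqrtr.
by rewrite l_inv lexx.
Qed.
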